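(* For every positive integer $n$, $$21\,t_n\equiv 0\pmod{10n+3},$$ where $t_n=\dfrac{\binom{15n}{5n}\binom{5n-1}{n-1}}{(10n+1)\binom{3n}{n}}$.
   Context: For a positive integer $n$, $t_n=\dfrac{\binom{15n}{5n}\binom{5n-1}{n-1}}{(10n+1)\binom{3n}{n}}$. It is a previously known result (Z.-W. Sun) that $t_n$ is an integer for every positive integer $n$; the congruence is between integers. *)

(* Defs.v *)
From mathcomp Require Import all_boot all_order all_algebra.

Set Implicit Arguments.
Unset Strict Implicit.
Unset Printing Implicit Defensive.

Import GRing.Theory Num.Theory.
Local Open Scope ring_scope.

(* The quotient is taken in [rat], so that it is exact. The truncated
   subtractions are the ordinary ones for [0 < n], the range of interest. *)
Definition t (n : nat) : rat :=
  ('C(15 * n, 5 * n) * 'C(5 * n - 1, n - 1))%:R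
    / ((10 * n + 1) * 'C(3 * n, n))%:R.

(* Main.v *)
Require Import Defs.
From mathcomp Require Import all_boot all_order all_algebra.
From mathcomp Require Import zify ring.

Import GRing.Theory Num.Theory.
Local Open Scope ring_scope.

(** Cancelling factorials, [t n = A / (5 (10n+1))] where
    [A = (15n)! (2n)! / ((10n)! (4n)! (3n)!)].  As [5], [10n+1] and [10n+3] are
    pairwise coprime, it suffices that [A] is an integer, that [5] and [10n+1]
    divide [A], and that [10n+3] divides [21 A].
    By Legendre's formula the [p]-adic valuation of [A] is the sum over the
    powers [q] of [p] of [f (n / q)], where
    [f x = |_15x_| + |_2x_| - |_10x_| - |_4x_| - |_3x_|] is nonnegative and
    [1]-periodic.  If [q > 1] divides [10n+1] or [10n+3], then [n / q] lies just
    below an odd multiple of [1/10], where [f] equals [1]; the only exceptions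
    are [q = 3] and [q = 7] for [10n+3], which the factor [21] absorbs.
    Finally, [v_5 ((5m)!) = m + v_5 (m!)] gives [v_5 A = n - v_5 ((4n)!)], which
    is positive because [4 v_5 (m!) < m]. *)

Section Legendre.
Local Open Scope nat_scope.

(** The terms with [k > m] vanish since [m < p ^ k]; a common limit [N] lets several valuations be
    compared term by term. *)
Lemma logn_fact_wide p m N : prime p -> m <= N ->
  logn p m`! = \sum_(1 <= k < N.+1) m %/ p ^ k.
Proof.
move=> p_pr le_mN; rewrite logn_fact // (@big_cat_nat _ _ _ m.+1 1 N.+1) //=.
rewrite [X in _ = _ + X]big_nat_cond [X in _ = _ + X]big1 ?addn0 // => k.
rewrite andbT => /andP[lt_mk _]; rewrite divn_small //.
by rewrite (ltn_trans lt_mk) // ltn_expl // prime_gt1.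
Qed.

Lemma logn_count_dvd_wide p m N : prime p -> 0 < m -> m <= N ->
  logn p m = \sum_(1 <= k < N.+1) (p ^ k %| m).
Proof.
move=> p_pr m_gt0 le_mN; rewrite logn_count_dvd //.
rewrite (@big_cat_nat _ _ _ m 1 N.+1) //=; last exact: leqW.
rewrite [X in _ = _ + X]big_nat_cond [X in _ = _ + X]big1 ?addn0 // => k.
rewrite andbT => /andP[le_mk _]; case: (boolP (_ %| _)) => // /dvdn_leq-/(_ m_gt0).
by rewrite leqNgt (leq_ltn_trans le_mk) // ltn_expl // prime_gt1.
Qed.

Lemma logn_fact_divn p m : prime p ->
  logn p m`! = m %/ p + logn p (m %/ p)`!.
Proof.
move=> p_pr; rewrite (@logn_fact_wide p m m.+1) // big_nat_recl //= expn1.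
rewrite (@logn_fact_wide p (m %/ p) m) ?leq_div //; congr (_ + _).
by apply: eq_bigr => k _; rewrite expnS divnMA.
Qed.

(** With [m' = m %/ p], induction gives [(p-1) * (m' + v) < (p-1) * m' + m' = p * m' <= m]. *)
Lemma logn_fact_ltn p m : prime p -> 0 < m -> p.-1 * logn p m`! < m.
Proof.
move=> p_pr; elim/ltn_ind: m => m IHm m_gt0; rewrite logn_fact_divn //.
have p_gt1 := prime_gt1 p_pr.
have [->|m'_gt0] := posnP (m %/ p); first by rewrite fact0 logn1 muln0.
have lt_v := IHm _ (ltn_Pdiv p_gt1 m_gt0) m'_gt0.
have := leq_divM m p; nia.
Qed.

Lemma dvdn_logn_le a b : 0 < a -> 0 < b ->
  (forall p, prime p -> logn p a <= logn p b) -> a %| b.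
Proof.
move=> a_gt0 b_gt0 le_ab; apply/dvdn_partP => // p.
rewrite mem_primes => /andP[p_pr _].
by rewrite p_part pfactor_dvdn // le_ab.
Qed.

End Legendre.

Section FactorialQuotient.
Local Open Scope nat_scope.

Definition fact_num n := (2 * n)`! * (15 * n)`!.
Definition fact_den n := (10 * n)`! * (4 * n)`! * (3 * n)`!.
Definition floor_num n q := 2 * n %/ q + 15 * n %/ q.
Definition floor_den n q := 10 * n %/ q + 4 * n %/ q + 3 * n %/ q.

(** Each prime power [q = p ^ k] contributes one term to each side of the inequality of [p]-adic
    valuations; the booleans count the powers dividing [M] and [c]. *)
Lemma dvdn_den_num n M c : 0 < M -> 0 < c ->
  (forall q, 1 < q ->
     (q %| M) + floor_den n q <= (q %| c) + floor_num n q) ->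
  M * fact_den n %| c * fact_num n.
Proof.
move=> M_gt0 c_gt0 le_q.
apply: dvdn_logn_le; rewrite ?muln_gt0 ?M_gt0 ?c_gt0 ?fact_gt0 // => p p_pr.
rewrite !lognM ?muln_gt0 ?fact_gt0 //.
pose N := M + c + 15 * n.
rewrite (@logn_count_dvd_wide p M N) ?(@logn_count_dvd_wide p c N) //;
  try by rewrite /N; lia.
rewrite !(fun m => @logn_fact_wide p m N p_pr); try by rewrite /N; lia.
rewrite -!big_split /= big_nat_cond [leqRHS]big_nat_cond.
apply: leq_sum => k /andP[/andP[k_gt0 _] _].
by apply: le_q; rewrite -(exp1n k) ltn_exp2r // prime_gt1.
Qed.

(** Periodicity: since [2 + 15 = 10 + 4 + 3], the multiples of [n %/ q] cancel. *)
Lemma floor_modn n q e : 0 < q ->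
  e + floor_den (n %% q) q <= floor_num (n %% q) q ->
  e + floor_den n q <= floor_num n q.
Proof.
move=> q_gt0; have divE a : a * n %/ q = a * (n %/ q) + a * (n %% q) %/ q.
  by rewrite {1}(divn_eq n q) mulnDr mulnA divnMDl.
by rewrite /floor_den /floor_num !divE; lia.
Qed.

Lemma floor_mulP a r q : r < q -> 0 < a ->
  exists2 i, i < a & a * r %/ q = i /\ i * q <= a * r < i.+1 * q.
Proof.
move=> lt_rq a_gt0; have q_gt0 : 0 < q by apply: leq_trans lt_rq.
exists (a * r %/ q); first by rewrite ltn_divLR // ltn_pmul2l.
by rewrite leq_divM ltn_ceil.
Qed.

Lemma floor_den_le_num n q : 0 < q -> floor_den n q <= floor_num n q.
Proof.
move=> q_gt0; apply: (@floor_modn n q 0 q_gt0); rewrite add0n.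
move: (n %% q) (ltn_pmod n q_gt0) => {n} r lt_rq; rewrite /floor_den /floor_num.
(* The floors at 10, 4, 3 and 2 take finitely many values; the consistent combinations leave a lower
   bound on [15 * r %/ q]. *)
have [[|[|[|[|[|[|[|[|[|[|//]]]]]]]]]] _ [-> Ha]] := @floor_mulP 10 r q lt_rq isT;
have [[|[|[|[|//]]]] _ [-> Hb]] := @floor_mulP 4 r q lt_rq isT; try lia;
have [[|[|[|//]]] _ [-> Hc]] := @floor_mulP 3 r q lt_rq isT; try lia;
have [[|[|//]] _ [-> Hd]] := @floor_mulP 2 r q lt_rq isT; try lia;
by rewrite -leq_subLR leq_divRL //; lia.
Qed.

Lemma floor_den_lt_num n q d : q %| 10 * n + d ->
  d = 1 /\ 2 < q \/ d = 3 /\ 8 < q -> floor_den n q < floor_num n q.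
Proof.
move=> dvd_q d_q; have q_gt0 : 0 < q by lia.
apply: (@floor_modn n q 1 q_gt0).
have {dvd_q} /dvdnP[s def_s] : q %| 10 * (n %% q) + d.
  by rewrite /dvdn -modnDml modnMmr modnDml.
move: (n %% q) (ltn_pmod n q_gt0) def_s => {n} r lt_rq def_s.
have le_s : s < 11 by rewrite -(ltn_pmul2r q_gt0) -def_s; lia.
rewrite /floor_den /floor_num.
have [i _ [-> Ha]] := @floor_mulP 10 r q lt_rq isT.
(* Here [10 * r = s * q - d] with [0 < d < q]. *)
have {Ha} def_i : s = i.+1 by nia.
have [[|[|[|[|//]]]] _ [-> Hb]] := @floor_mulP 4 r q lt_rq isT;
have [[|[|[|//]]] _ [-> Hc]] := @floor_mulP 3 r q lt_rq isT; try lia;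
have [[|[|//]] _ [-> Hd]] := @floor_mulP 2 r q lt_rq isT; try lia;
(* As [10 * r + d] is prime to 10, only [s] = 1, 3, 7, 9 survive. *)
subst s; move: i le_s def_s => [|[|[|[|[|[|[|[|[|[|//]]]]]]]]]] _ def_s; try lia;
by rewrite -leq_subLR leq_divRL //; lia.
Qed.

Lemma dvdn_den_num10n1 n : (10 * n + 1) * fact_den n %| fact_num n.
Proof.
rewrite -[fact_num n]mul1n; apply: dvdn_den_num => // [|q q_gt1]; first lia.
have := @floor_den_le_num n q (ltnW q_gt1).
case: (boolP (q %| 10 * n + 1)) => [dvd_q|_]; last by lia.
have ? : q != 2 by apply/eqP=> q2; move: dvd_q; rewrite q2; lia.
by have := floor_den_lt_num n q 1 dvd_q; lia.
Qed.

Lemma dvdn_den_num10n3 n : (10 * n + 3) * fact_den n %| 21 * fact_num n.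
Proof.
apply: dvdn_den_num => // [|q q_gt1]; first lia.
have := @floor_den_le_num n q (ltnW q_gt1).
case: (boolP (q %| 10 * n + 3)) => [dvd_q|_]; last by lia.
case: (ltnP 8 q) => [q_gt8 | q_le8].
  by have := floor_den_lt_num n q 3 dvd_q; lia.
(* A divisor of [10 * n + 3] is prime to 10, so [q] is 3 or 7. *)
suff -> : q %| 21 by [].
move: q q_gt1 q_le8 dvd_q => [|[|[|[|[|[|[|[|[|//]]]]]]]]] //; lia.
Qed.

Lemma logn5_den_lt_num n : 0 < n -> logn 5 (fact_den n) < logn 5 (fact_num n).
Proof.
move=> n_gt0; rewrite !lognM ?muln_gt0 ?fact_gt0 //.
rewrite (@logn_fact_divn 5 (15 * n)) // (@logn_fact_divn 5 (10 * n)) //.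
have -> : 15 * n %/ 5 = 3 * n by rewrite -(@mulnA 5 3 n) mulKn.
have -> : 10 * n %/ 5 = 2 * n by rewrite -(@mulnA 5 2 n) mulKn.
have := @logn_fact_ltn 5 (4 * n) isT.
(* The valuations of [(3 * n)!] and [(2 * n)!] occur on both sides and cancel. *)
by move: (logn _ _) (logn _ _) (logn _ _) => u v w; lia.
Qed.

Lemma factorial_quotient n : 0 < n -> exists m,
  fact_num n = 5 * (10 * n + 1) * m * fact_den n /\ 10 * n + 3 %| 21 * m.
Proof.
move=> n_gt0; have den_gt0 : 0 < fact_den n by rewrite !muln_gt0 !fact_gt0.
have num_gt0 : 0 < fact_num n by rewrite !muln_gt0 !fact_gt0.
have [A defA] : exists A, fact_num n = A * fact_den n.
  by apply/dvdnP; apply: dvdn_trans (dvdn_den_num10n1 n); rewrite dvdn_mull.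
have A_gt0 : 0 < A by move: num_gt0; rewrite defA muln_gt0 => /andP[].
have dvd5 : 5 %| A.
  have := logn5_den_lt_num n n_gt0; rewrite defA lognM //.
  rewrite -[X in X < _]add0n ltn_add2r.
  by rewrite -(@pfactor_dvdn 5 1 A).
have dvd1 : 10 * n + 1 %| A.
  by rewrite -(dvdn_pmul2r den_gt0) -defA dvdn_den_num10n1.
have dvd3 : 10 * n + 3 %| 21 * A.
  by rewrite -(dvdn_pmul2r den_gt0) -mulnA -defA dvdn_den_num10n3.
have co5 d : 0 < d < 5 -> coprime 5 (10 * n + d).
  by move=> d_lt5; rewrite prime_coprime //; lia.
(* Both numbers are odd and they differ by 2. *)
have co13 : coprime (10 * n + 3) (10 * n + 1).
  rewrite (_ : 10 * n + 3 = 2 + (10 * n + 1)); last lia.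
  rewrite coprime_sym /coprime gcdnDr -/(coprime _ _) coprime_sym.
  by rewrite prime_coprime //; lia.
have /dvdnP[m defm] : 5 * (10 * n + 1) %| A by rewrite Gauss_dvd ?dvd5 ?co5.
exists m; rewrite defA defm (mulnC m); split=> //.
move: dvd3; rewrite defm mulnA Gauss_dvdl // coprimeMr co13 andbT.
by rewrite coprime_sym co5.
Qed.

Lemma binomial_quotient n m : 0 < n ->
  fact_num n = 5 * (10 * n + 1) * m * fact_den n ->
  'C(15 * n, 5 * n) * 'C(5 * n - 1, n - 1) = m * ((10 * n + 1) * 'C(3 * n, n)).
Proof.
move=> n_gt0 def_num.
have bin15 := @bin_fact (15 * n) (5 * n); have bin3 := @bin_fact (3 * n) n.
have bin5 := @bin_fact (5 * n - 1) (n - 1).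
rewrite (_ : 15 * n - 5 * n = 10 * n) in bin15; last lia.
rewrite (_ : 3 * n - n = 2 * n) in bin3; last lia.
rewrite (_ : 5 * n - 1 - (n - 1) = 4 * n) in bin5; last lia.
(* The factor 5 in the hypothesis comes from the ratio of [5 * n] to [n] in this identity and the
   next. *)
have fact5 : (5 * n)`! = 5 * n * (5 * n - 1)`!.
  by rewrite -[in LHS](subnK (n := 5 * n) (m := 1)) ?addn1 ?factS; [congr (_ * _)|]; lia.
have fact1 : n`! = n * (n - 1)`!.
  by case: (n) n_gt0 => // k _; rewrite factS subn1.
have {}bin15 : 'C(15 * n, 5 * n) * ((5 * n)`! * (10 * n)`!) = (15 * n)`!
  by apply: bin15; lia.
have {}bin3 : 'C(3 * n, n) * (n`! * (2 * n)`!) = (3 * n)`!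
  by apply: bin3; lia.
have {}bin5 : 'C(5 * n - 1, n - 1) * ((n - 1)`! * (4 * n)`!) = (5 * n - 1)`!.
  by apply: bin5; lia.
(* [D] clears the denominators of all three binomials at once. *)
pose D := (5 * n)`! * (10 * n)`! * ((n - 1)`! * (4 * n)`!) * (n`! * (2 * n)`!).
have D_gt0 : 0 < D by rewrite !muln_gt0 !fact_gt0.
apply/eqP; rewrite -(eqn_pmul2r D_gt0); apply/eqP.
transitivity (fact_num n * (5 * n - 1)`! * n`!).
  by rewrite /fact_num -bin15 -bin5 /D; ring.
rewrite def_num /fact_den -bin3 /D fact5 fact1; ring.
Qed.

End FactorialQuotient.

Theorem theorem1p2 (n : nat) (hn : (0 < n)%N) :
  exists m : int,
    t n = m%:~R /\ (21 * m = 0 %[mod (10 * n + 3)%N%:Z])%Z.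
Proof.
have [m [def_num dvd_m]] := @factorial_quotient n hn.
exists m%:Z; split; last first.
  by apply/eqP; rewrite eqz_mod_dvd subr0 -[21]/(21%:Z) -PoszM /dvdz /=.
rewrite /t (@binomial_quotient n m hn def_num) natrM mulfK //.
by rewrite pnatr_eq0 -lt0n muln_gt0 bin_gt0; apply/andP; split; lia.
Qed.
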